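(* Let $K$ be an infinite field. Every S-squeezed sphere has the weak Lefschetz property (over $K$). That is, for all integers $n>d>0$ and every shifted order ideal $U\subset R_{[n-d-1]}$ of monomials of degree at most $\lfloor\frac d2\rfloor$, the squeezed $(d-1)$-sphere $S_d(U)$ on $[n]$ has the weak Lefschetz property.
   Context: $K$ is an infinite field, $R_{[n]}=K[x_1,\dots,x_n]$ with each $\deg x_i=1$ ($R_{[0]}=K$), and $[n]=\{1,\dots,n\}$. The Stanley--Reisner ideal $I_\Gamma\subset R_{[n]}$ of a simplicial complex $\Gamma$ on $[n]$ is generated by all squarefree monomials $x_{i_1}\cdots x_{i_k}$ with $\{i_1,\dots,i_k\}\notin\Gamma$. For monomials $u=x_{i_1}\cdots x_{i_k}$, $v=x_{j_1}\cdots x_{j_k}$ of the same degree with $i_1\le\cdots\le i_k$, $j_1\le\cdots\le j_k$, write $u\preceq v$ if $i_p\le j_p$ for all $p$. A set $U$ of monomials of $R_{[m]}$ is a shifted order ideal of monomials if (i) $\{1,x_1,\dots,x_m\}\subset U$; (ii) $u\in U$ and $v$ divides $u$ imply $v\in U$; (iii) $u\in U$, $v\in R_{[m]}$ a monomial and $u\preceq v$ imply $v\in U$. It is ''of degree at most $k$'' if all its elements have degree at most $k$. Squeezed balls and spheres: with $m=n-d-1$ and $U\subset R_{[m]}$ a shifted order ideal of monomials of degree at most $\lfloor\frac{d+1}{2}\rfloor$, for $u=x_{i_1}\cdots x_{i_k}\in U$ with $i_1\le\cdots\le i_k$ put $$F_d(u)=\{i_1,i_1+1\}\cup\{i_2+2,i_2+3\}\cup\cdots\cup\{i_k+2(k-1),i_k+2k-1\}\cup\{n+2k-d,n+2k-d+1,\dots,n\},$$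 a $(d+1)$-subset of $[n]$ (with $F_d(1)=\{n-d,\dots,n\}$). The squeezed $d$-ball $B_d(U)$ is the simplicial complex generated by $\{F_d(u):u\in U\}$; it is a shellable $d$-ball, and the squeezed $(d-1)$-sphere $S_d(U)$ is its boundary, i.e. the complex generated by the $d$-subsets of $[n]$ contained in exactly one facet of $B_d(U)$. If moreover $U$ has degree at most $\lfloor\frac d2\rfloor$, $S_d(U)$ is called an S-squeezed $(d-1)$-sphere. A $(d-1)$-dimensional Gorenstein* complex $\Gamma$ on $[n]$ (in particular any simplicial $(d-1)$-sphere) has the weak Lefschetz property if there are a system of parameters $\vartheta_1,\dots,\vartheta_d$ of $R_{[n]}/I_\Gamma$ consisting of linear forms and a linear form $\omega\in R_{[n]}$ such that the multiplication map $\omega:H_{i-1}(\Gamma)\to H_i(\Gamma)$ is injective for $1\le i\le\lfloor\frac d2\rfloor$ and surjective for $i>\lfloor\frac d2\rfloor$, where $H_i(\Gamma)$ is the $i$-th homogeneous component of $(R_{[n]}/I_\Gamma)\otimes(R_{[n]}/\langle\vartheta_1,\dots,\vartheta_d\rangle)$. *)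

(* Defs.v *)
From mathcomp Require Import all_boot all_order all_algebra.
From mathcomp Require Import boolp mpoly.

Set Implicit Arguments.
Unset Strict Implicit.
Unset Printing Implicit Defensive.

Import GRing.Theory.
Local Open Scope ring_scope.

Definition infinite_type (T : eqType) : Prop :=
  forall s : seq T, exists x, x \notin s.

(** A vertex [v] of [[n] = {1, ..., n}] is encoded by the [i : 'I_n] with
   [i.+1 = v], and a simplicial complex on [[n]] by its set of faces (the empty
   face included). *)

Definition complex_gen n (S : {set {set 'I_n}}) : {set {set 'I_n}} :=
  [set F : {set 'I_n} | [exists G in S, F \subset G]].

Definition facets n (Gamma : {set {set 'I_n}}) : {set {set 'I_n}} :=
  [set F : {set 'I_n} | maxset [pred G | G \in Gamma] F].

(** [(dim Gamma).+1], which is the Krull dimension of [K[Gamma]]. *)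
Definition complex_rank n (Gamma : {set {set 'I_n}}) : nat :=
  (\max_(F in Gamma) #|F|)%N.

(** The boundary of a [d]-dimensional ball: its facets have [d + 1] elements. *)
Definition ball_boundary n (d : nat) (B : {set {set 'I_n}}) : {set {set 'I_n}} :=
  complex_gen
    [set G : {set 'I_n} | (#|G| == d)
                       && (#|[set F in facets B | G \subset F]| == 1)]%N.

(** [u = x_{i_1} ... x_{i_k}] with [i_1 <= ... <= i_k] gives
   [[:: i_1; ...; i_k]]; indices start at 1, not 0. *)
Definition mvars m (u : 'X_{1..m}) : seq nat :=
  flatten [seq nseq (u i) (i : nat).+1 | i <- enum 'I_m].

Definition mnm_shift_le m (u v : 'X_{1..m}) : Prop :=
  mdeg u = mdeg v /\
  forall p, (p < mdeg u)%N -> (nth 0 (mvars u) p <= nth 0 (mvars v) p)%N.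

(** For monomials, [(v <= u)%MM] is divisibility of [u] by [v]. *)
Definition shifted_order_ideal m (U : 'X_{1..m} -> Prop) : Prop :=
  [/\ U 0%MM /\ (forall i : 'I_m, U U_(i)%MM),
      forall u v : 'X_{1..m}, U u -> (v <= u)%MM -> U v
    & forall u v : 'X_{1..m}, U u -> mnm_shift_le u v -> U v].

Definition degree_at_most m (k : nat) (U : 'X_{1..m} -> Prop) : Prop :=
  forall u, U u -> (mdeg u <= k)%N.

(** [F_d(u)]: with [p] counted from 0, the [p]-th pair is
   [{i + 2 p, i + 2 p + 1}] where [i = nth 0 (mvars u) p]. *)
Definition squeezed_facet n d (u : 'X_{1..n - d - 1}) : {set 'I_n} :=
  let k := mdeg u in
  [set v : 'I_n |
    [exists p : 'I_k, (v.+1 == nth 0 (mvars u) p + 2 * p)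
                   || (v.+1 == nth 0 (mvars u) p + 2 * p + 1)]
    || (n + 2 * k - d <= v.+1)]%N.

Arguments squeezed_facet : clear implicits.

Definition squeezed_ball n d (U : 'X_{1..n - d - 1} -> Prop) :
    {set {set 'I_n}} :=
  complex_gen [set F | `[< exists2 u, U u & F = squeezed_facet n d u >]].

Arguments squeezed_ball : clear implicits.

Definition squeezed_sphere n d (U : 'X_{1..n - d - 1} -> Prop) :
    {set {set 'I_n}} :=
  ball_boundary d (squeezed_ball n d U).

Arguments squeezed_sphere : clear implicits.

Definition ideal_gen (R : comNzRingType) (S : R -> Prop) (p : R) : Prop :=
  exists s : seq (R * R),
    (forall cg, cg \in s -> S cg.2) /\ p = \sum_(cg <- s) cg.1 * cg.2.

Definition stanley_reisner_ideal (K : fieldType) n (Gamma : {set {set 'I_n}}) :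
    {mpoly K[n]} -> Prop :=
  ideal_gen (fun p => exists2 F : {set 'I_n},
    F \notin Gamma & p = \prod_(i in F) 'X_i).

(** [I_Gamma + (theta)], so that [R / I_Gamma (x) R / (theta)] is [R] modulo
   this ideal. *)
Definition reduction_ideal (K : fieldType) n (Gamma : {set {set 'I_n}})
    (d : nat) (theta : 'I_d -> {mpoly K[n]}) : {mpoly K[n]} -> Prop :=
  ideal_gen (fun p => stanley_reisner_ideal Gamma p \/ exists i, p = theta i).

Definition finite_dim_quotient (K : fieldType) n (J : {mpoly K[n]} -> Prop) :
    Prop :=
  exists b : seq {mpoly K[n]}, forall p : {mpoly K[n]},
    exists c : 'I_(size b) -> K, J (p - \sum_(j < size b) c j *: b`_j).

(** As many linear forms as the Krull dimension of [R / I_Gamma], with a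
   finite-dimensional quotient. *)
Definition linear_sop (K : fieldType) n (Gamma : {set {set 'I_n}})
    (theta : 'I_(complex_rank Gamma) -> {mpoly K[n]}) : Prop :=
  (forall i, theta i \is 1.-homog) /\
  finite_dim_quotient (reduction_ideal Gamma theta).

(** Multiplication by a linear form [w], as a map from degree [i] to degree
   [j = i + 1] of [R / J] with [J] a homogeneous ideal; elements of a graded
   component are represented by forms of that degree, up to congruence
   modulo [J]. *)
Definition mul_injective (K : fieldType) n (J : {mpoly K[n]} -> Prop)
    (w : {mpoly K[n]}) (i : nat) : Prop :=
  forall f g : {mpoly K[n]}, f \is i.-homog -> g \is i.-homog ->
    J (w * f - w * g) -> J (f - g).

Definition mul_surjective (K : fieldType) n (J : {mpoly K[n]} -> Prop)
    (w : {mpoly K[n]}) (i j : nat) : Prop :=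
  forall g : {mpoly K[n]}, g \is j.-homog ->
    exists2 f : {mpoly K[n]}, f \is i.-homog & J (w * f - g).

Definition weak_lefschetz (K : fieldType) n (Gamma : {set {set 'I_n}}) : Prop :=
  let d := complex_rank Gamma in
  exists (theta : 'I_d -> {mpoly K[n]}) (w : {mpoly K[n]}),
    let J := reduction_ideal Gamma theta in
    [/\ linear_sop theta,
        w \is 1.-homog,
        forall i, (1 <= i <= d./2)%N -> mul_injective J w i.-1
      & forall i, (d./2 < i)%N -> mul_surjective J w i.-1 i].

(* Main.v *)
Require Import Defs.
From mathcomp Require Import all_boot all_order all_algebra.
From mathcomp Require Import boolp mpoly.
From mathcomp Require Import ring zify.

Set Implicit Arguments.
Unset Strict Implicit.
Unset Printing Implicit Defensive.

Import GRing.Theory.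
Local Open Scope ring_scope.

(** Let [B] be the squeezed ball, [S] its boundary, and let the linear forms be
   [theta k = \sum_i t i ^+ k *: 'X_i] for distinct scalars [t i], where
   [theta 0], ..., [theta d.-1] serve as system of parameters and [theta d] as
   Lefschetz element.  The choice is a Vandermonde matrix: the first [k] of these
   forms restrict to linearly independent forms on any [k] vertices.

   The ball is shellable, and the restriction of the facet [F_d(u)] has [mdeg u]
   elements, which is at most [d./2] here.  Three consequences combine.

   - Modulo all of [theta 0], ..., [theta d] the face ring of [B] is spanned by
     the monomials of the restrictions, so it vanishes in degrees above [d./2]
     ([shelling_high_degree]).  Hence multiplication by [theta d] is onto in these
     degrees modulo the other forms, for [B] and so for its subcomplex [S].
   - The face ring of [B] is Cohen-Macaulay, and [theta 0], ..., [theta d] is a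
     regular sequence on it ([regular_seq_shelling]).  Hence multiplication by
     [theta d] is injective modulo the other forms, in every degree, for [B].
   - A face of [B] that is not in [S] contains the complement, in some facet, of
     the restriction of that facet, so it has more than [d./2] vertices
     ([ball_boundary_small]).  The face rings of [B] and [S] thus agree up to
     degree [d./2], and injectivity passes to [S] in this range.

   To shell the ball, the monomial [x_{i_0} ... x_{i_(k-1)}] is read as the weakly
   increasing function [a] with [a p = i_p] for [p < k] and [a p = n - d] from [k]
   on.  Its facet then consists of the vertices [a (t./2) + t] for [t <= d], with
   no special case for the tail, and its restriction of the vertices [a p + 2 p]
   for [p < k].  Facets are shelled by decreasing values of [a]: removing
   [a p + 2 p] leads into the facet of the monomial in which the indices equal to
   [i_p], from position [p] on, are raised by one or, when they equal [n - d - 1],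
   dropped, and this monomial is in [U] because [U] is a shifted
   order ideal ([shifted_order_ideal_raise]). *)

(** * Regular sequences modulo an ideal *)

Definition is_ideal (R : comNzRingType) (I : R -> Prop) : Prop :=
  [/\ I 0, forall p q, I p -> I q -> I (p + q) & forall a p, I p -> I (a * p)].

(** The ideal [I + (theta 0, ..., theta k.-1)]. *)
Definition adjoin (R : comNzRingType) (I : R -> Prop) (theta : nat -> R)
    (k : nat) (p : R) : Prop :=
  exists a : nat -> R, I (p - \sum_(i < k) theta i * a i).

(** [theta] need not generate a proper ideal modulo [I]: regularity in this weak
   sense holds when [I] is the whole ring, which starts inductions. *)
Definition regular_seq (R : comNzRingType) (I : R -> Prop) (theta : nat -> R)
    (k : nat) : Prop :=
  forall j p, (j < k)%N ->
    adjoin I theta j (theta j * p) -> adjoin I theta j p.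

Lemma is_idealB (R : comNzRingType) (I : R -> Prop) (p q : R) :
  is_ideal I -> I p -> I q -> I (p - q).
Proof. by case=> _ ID IM Ip Iq; rewrite -mulN1r; apply/ID/IM. Qed.

Lemma is_ideal_sum (R : comNzRingType) (I : R -> Prop) (T : Type) (s : seq T)
    (P : pred T) (F : T -> R) :
  is_ideal I -> (forall i, P i -> I (F i)) -> I (\sum_(i <- s | P i) F i).
Proof. by case=> I0 ID _ IF; elim/big_ind: _. Qed.

Lemma sum_mulD (R : comNzRingType) (theta u v : nat -> R) (y : R) (k : nat) :
  \sum_(i < k) theta i * (u i + y * v i) =
  \sum_(i < k) theta i * u i + y * \sum_(i < k) theta i * v i.
Proof. by rewrite mulr_sumr -big_split; apply: eq_bigr => i _ /=; ring. Qed.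

Lemma is_ideal_adjoin (R : comNzRingType) (I : R -> Prop) (theta : nat -> R)
    (k : nat) :
  is_ideal I -> is_ideal (adjoin I theta k).
Proof.
move=> idI; have [I0 ID IM] := idI; split.
- by exists (fun=> 0); rewrite big1 ?subr0 // => i _; rewrite mulr0.
- move=> p q [a Ia] [b Ib]; exists (fun i => a i + 1 * b i).
  by rewrite /= (sum_mulD theta a b) mul1r opprD addrACA; apply: ID.
- move=> c p [a Ia]; exists (fun i => 0 + c * a i).
  rewrite /= (sum_mulD theta (fun=> 0) a) big1 ?add0r -?mulrBr => [|i _];
    last by rewrite mulr0.
  exact: IM.
Qed.

Lemma adjoin_base (R : comNzRingType) (I : R -> Prop) (theta : nat -> R)
    (k : nat) (p : R) : I p -> adjoin I theta k p.
Proof.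
by exists (fun=> 0); rewrite big1 ?subr0 // => i _; rewrite mulr0.
Qed.

Lemma adjoin_gen (R : comNzRingType) (I : R -> Prop) (theta : nat -> R)
    (k j : nat) : is_ideal I -> (j < k)%N -> adjoin I theta k (theta j).
Proof.
move=> [I0 _ _] ltjk; exists (fun i => (i == j)%:R).
rewrite (bigD1 (Ordinal ltjk)) //= eqxx mulr1 big1 ?addr0 ?subrr // => i.
by rewrite -val_eqE /= => /negPf->; rewrite mulr0.
Qed.

(** A regular sequence modulo [I] has only the Koszul syzygies, and those
   contribute zero: the intersection of [(theta)] and [I] is their product. *)
Lemma regular_seq_meet (R : comNzRingType) (I : R -> Prop) (theta : nat -> R)
    (k : nat) (a : nat -> R) :
  is_ideal I -> regular_seq I theta k -> I (\sum_(i < k) theta i * a i) ->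
  exists2 b : nat -> R, forall i, I (b i) &
    \sum_(i < k) theta i * a i = \sum_(i < k) theta i * b i.
Proof.
move=> idI; have [I0 ID IM] := idI.
elim: k a => [|k IHk] a reg.
  by exists (fun=> 0); rewrite // !big_ord0.
rewrite big_ord_recr /= => Ia.
have [|c Ic] := reg k (a k) (ltnSn k).
  exists (fun i => 0 + (-1) * a i).
  rewrite /= (sum_mulD theta (fun=> 0) a) big1 => [|i _]; last first.
    by rewrite mulr0.
  by rewrite add0r mulN1r opprK addrC.
have [||b Ib eb] := IHk (fun i => a i + theta k * c i).
- by move=> j p ltjk; apply: reg; apply: ltnW.
- rewrite /= (sum_mulD theta a c).
  have -> : \sum_(i < k) theta i * a i + theta k * \sum_(i < k) theta i * c i =
    \sum_(i < k) theta i * a i + theta k * a k -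
    theta k * (a k - \sum_(i < k) theta i * c i) by ring.
  by apply: is_idealB => //; apply: IM.
exists (fun i => if i == k then a k - \sum_(i < k) theta i * c i else b i).
  by move=> i; case: eqP.
rewrite big_ord_recr /= eqxx.
rewrite [X in _ = X + _](_ : _ = \sum_(i < k) theta i * b i); last first.
  by apply: eq_bigr => i _; rewrite ltn_eqF.
by rewrite -eb (sum_mulD theta a c); ring.
Qed.

(** Regularity passes to the middle term of the exact sequence
   [0 -> R/P -> R/I -> R/I0 -> 0] whose first map is multiplication by [x].
   Reduction modulo the first [j] forms keeps it exact on the left, because they
   are regular modulo [I0] ([regular_seq_meet]). *)
Lemma regular_seq_extension (R : comNzRingType) (I I0 P : R -> Prop) (x : R)
    (theta : nat -> R) (k : nat) :
  is_ideal I -> is_ideal I0 -> I0 x ->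
  (forall p, I p -> I0 p) ->
  (forall p, I0 p -> exists c, I (p - x * c)) ->
  (forall q, I (x * q) <-> P q) ->
  regular_seq I0 theta k -> regular_seq P theta k -> regular_seq I theta k.
Proof.
move=> idI idI0 I0x subI genI colI reg0 regP j p ltjk [a Ia].
have [I_0 ID IM] := idI; have [_ I0D I0M] := idI0.
have [|b /genI[c Ic]] := reg0 j p ltjk; first by exists a; apply: subI.
(* Comparing the two expressions of [theta j * p] moves the question about [p]
   to the part [x * c] of [p] that comes from [R/P]. *)
have /= Ixc : I (x * (theta j * c)
    - \sum_(i < j) theta i * (a i + (- theta j) * b i)).
  rewrite (sum_mulD theta a b).
  set A := \sum_(i < j) _ in Ia *; set B := \sum_(i < j) _ in Ic *.
  have -> : x * (theta j * c) - (A + - theta j * B) =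
    (theta j * p - A) - theta j * (p - B - x * c) by ring.
  by apply: is_idealB => //; apply: IM.
have [||f I0f ef] := @regular_seq_meet _ I0 theta j
    (fun i => a i + (- theta j) * b i) idI0.
- by move=> i q ltij; apply: reg0; apply: ltn_trans ltjk.
- rewrite -[X in I0 X](subKr (x * (theta j * c))).
  by apply: is_idealB; [|rewrite mulrC; apply: I0M|apply: subI].
have [g Ig] := choice (fun i => genI _ (I0f i)).
have Pc : P (theta j * c - \sum_(i < j) theta i * g i).
  apply/colI; rewrite mulrBr.
  have -> : x * (theta j * c) - x * (\sum_(i < j) theta i * g i) =
    (x * (theta j * c) - \sum_(i < j) theta i * f i) +
    (\sum_(i < j) theta i * (f i + (- x) * g i)) by rewrite (sum_mulD theta f g); ring.
  apply: ID; first by rewrite -ef.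
  by apply: is_ideal_sum => // i _; apply: IM; rewrite mulNr.
have [|h /colI Ih] := regP j c ltjk; first by exists g.
exists (fun i => b i + x * h i); rewrite /= (sum_mulD theta b h).
set B := \sum_(i < j) _ in Ic *; set H := \sum_(i < j) _ in Ih *.
have -> : p - (B + x * H) = (p - B - x * c) + x * (c - H) by ring.
exact: ID.
Qed.

(** * Ideals of non-faces *)

Definition mnm_support n (m : 'X_{1..n}) : {set 'I_n} := [set i | m i != 0%N].

(** For [Gamma] closed under subsets this is the Stanley-Reisner ideal. *)
Definition nonface_ideal (K : fieldType) n (Gamma : {set {set 'I_n}})
    (p : {mpoly K[n]}) : Prop :=
  forall m, mnm_support m \in Gamma -> p@_m = 0.

Definition subset_closed n (Gamma : {set {set 'I_n}}) : Prop :=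
  forall F G : {set 'I_n}, F \subset G -> G \in Gamma -> F \in Gamma.

Lemma mnm_supportD n (m m' : 'X_{1..n}) :
  mnm_support (m + m')%MM = mnm_support m :|: mnm_support m'.
Proof. by apply/setP => i; rewrite !inE mnmDE addn_eq0 negb_and. Qed.

Lemma mnm_support1 n (i : 'I_n) : mnm_support U_(i)%MM = [set i].
Proof. by apply/setP => j; rewrite !inE mnm1E eqb0 negbK eq_sym. Qed.

Lemma complex_genP n (S : {set {set 'I_n}}) (F : {set 'I_n}) :
  reflect (exists2 G, G \in S & F \subset G) (F \in complex_gen S).
Proof. by rewrite inE; apply: (iffP exists_inP). Qed.

Lemma complex_gen_closed n (S : {set {set 'I_n}}) :
  subset_closed (complex_gen S).
Proof.
move=> F G sFG /complex_genP[H SH sGH]; apply/complex_genP; exists H => //.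
exact: subset_trans sGH.
Qed.

Lemma nonface_idealX (K : fieldType) n (Gamma : {set {set 'I_n}})
    (m : 'X_{1..n}) :
  mnm_support m \notin Gamma -> nonface_ideal Gamma ('X_[m] : {mpoly K[n]}).
Proof.
by move=> Gm m'; rewrite mcoeffX; case: eqVneq => // <-; rewrite (negPf Gm).
Qed.

Lemma is_ideal_nonface (K : fieldType) n (Gamma : {set {set 'I_n}}) :
  subset_closed Gamma -> is_ideal (@nonface_ideal K n Gamma).
Proof.
move=> clG; split=> [m _|p q Ip Iq m Gm|a p Ip m Gm]; first by rewrite mcoeff0.
- by rewrite mcoeffD Ip ?Iq ?addr0.
apply: memN_msupp_eq0; apply/negP => /msuppM_le/allpairsP[[m1 m2] /= [_ pm2 em]].
move: pm2; rewrite mcoeff_msupp Ip ?eqxx //.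
by apply: clG Gm; rewrite em mnm_supportD subsetUr.
Qed.

Lemma ideal_scale (K : fieldType) n (I : {mpoly K[n]} -> Prop) (c : K)
    (p : {mpoly K[n]}) : is_ideal I -> I p -> I (c *: p).
Proof. by case=> _ _ IM Ip; rewrite -mul_mpolyC; apply: IM. Qed.

Lemma ideal_of_monomials (K : fieldType) n (I : {mpoly K[n]} -> Prop)
    (p : {mpoly K[n]}) :
  is_ideal I -> {in msupp p, forall m, I 'X_[m]} -> I p.
Proof.
move=> idI Ip; rewrite [p]mpolyE big_seq.
by apply: is_ideal_sum => // m /Ip; apply: ideal_scale.
Qed.

(** * Vandermonde linear forms *)

Section Vandermonde.

Variables (K : fieldType) (n : nat) (t : 'I_n -> K).
Hypothesis t_inj : injective t.

(** Polynomials stand for linear forms, those of degree less than [k] for the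
   span of the first [k] Vandermonde forms. *)
Definition value_form (L : {poly K}) : {mpoly K[n]} :=
  \sum_(i < n) L.[t i] *: 'X_i.

Definition vandermonde_form (k : nat) : {mpoly K[n]} := value_form 'X^k.

Definition vanishing_poly (A : {set 'I_n}) : {poly K} :=
  \prod_(i in A) ('X - (t i)%:P).

Local Notation theta := vandermonde_form.

Lemma size_vanishing_poly A : size (vanishing_poly A) = #|A|.+1.
Proof. by rewrite /vanishing_poly -big_enum size_prod_XsubC -cardE. Qed.

Lemma vanishing_poly_eq0 A i : ((vanishing_poly A).[t i] == 0) = (i \in A).
Proof.
rewrite /vanishing_poly horner_prod; apply/prodf_eq0/idP.
  by case=> j Aj; rewrite hornerXsubC subr_eq0 => /eqP/t_inj->.
by move=> Ai; exists i; rewrite // hornerXsubC subrr.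
Qed.

Lemma value_form_homog L : value_form L \is 1.-homog.
Proof. by apply: rpred_sum => i _; apply: rpredZ; rewrite dhomogX /= mdeg1. Qed.

Lemma value_formE (L : {poly K}) k : (size L <= k)%N ->
  value_form L = \sum_(j < k) theta j * (L`_j)%:MP.
Proof.
move=> leLk; under eq_bigr do rewrite mulrC mul_mpolyC scaler_sumr.
rewrite exchange_big /=; apply: eq_bigr => i _.
rewrite (horner_coef_wide _ leLk) scaler_suml; apply: eq_bigr => j _.
by rewrite scalerA hornerXn.
Qed.

Lemma adjoin_value_form I (L : {poly K}) k : is_ideal I -> (size L <= k)%N ->
  adjoin I theta k (value_form L).
Proof.
move=> [I0 _ _] leLk; exists (fun j => (L`_j)%:MP).
by rewrite -value_formE // subrr.
Qed.

(** A polynomial of degree less than [k] vanishing on [F] except at [i] gives a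
   linear form in the ideal that expresses [x_i] by variables outside [F]. *)
Lemma vandermonde_eliminate I k (F : {set 'I_n}) i c :
  is_ideal I -> (#|F| <= k)%N -> i \in F ->
  (forall l, l \notin F -> adjoin I theta k ('X_l * c)) ->
  adjoin I theta k ('X_i * c).
Proof.
move=> idI leFk Fi Qc; have idQ := is_ideal_adjoin theta k idI.
have [Q0 QD QM] := idQ.
set L := vanishing_poly (F :\ i).
have Li : L.[t i] != 0 by rewrite vanishing_poly_eq0 !inE eqxx.
have QL : adjoin I theta k (value_form L * c).
  rewrite mulrC; apply/QM/adjoin_value_form => //.
  by rewrite size_vanishing_poly (cardsD1 i F) Fi in leFk *.
suff QLi : adjoin I theta k (L.[t i] *: ('X_i * c)).
  by have := ideal_scale L.[t i]^-1 idQ QLi; rewrite scalerA mulVf ?scale1r.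
have -> : L.[t i] *: ('X_i * c) =
    value_form L * c - \sum_(l < n | l != i) L.[t l] *: ('X_l * c).
  rewrite /value_form (bigD1 i) //= mulrDl mulr_suml scalerAl.
  under [X in _ - X]eq_bigr do rewrite scalerAl.
  by rewrite addrK.
apply: is_idealB => //; apply: is_ideal_sum => // l nli.
have [Fl|nFl] := boolP (l \in F); last by apply: ideal_scale => //; apply: Qc.
suff /eqP -> : L.[t l] == 0 by rewrite scale0r.
by rewrite vanishing_poly_eq0 !inE nli.
Qed.

Lemma lagrange_interpolation (G : {set 'I_n}) (L : {poly K}) (x : K) :
  (size L <= #|G|)%N ->
  L.[x] = \sum_(i in G) L.[t i] *
     ((vanishing_poly (G :\ i)).[x] / (vanishing_poly (G :\ i)).[t i]).
Proof.
move=> leLG; pose M i := vanishing_poly (G :\ i).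
pose D := L - \sum_(i in G) (L.[t i] / (M i).[t i]) *: M i.
suff D0 : D = 0.
  move/eqP: D0; rewrite subr_eq0 => /eqP {1}->; rewrite horner_sum.
  by apply: eq_bigr => i _; rewrite hornerZ; ring.
have szD : (size D <= #|G|)%N.
  rewrite (leq_trans (size_polyD _ _)) // geq_max leLG size_polyN.
  apply: leq_trans (size_sum _ _ _) _; apply/bigmax_leqP => i Gi.
  apply: leq_trans (size_scale_leq _ _) _.
  by rewrite size_vanishing_poly (cardsD1 i G) Gi.
apply/eqP; apply: contraTT szD => nzD; rewrite -ltnNge.
have -> : #|G| = size [seq t i | i in G] by rewrite size_map cardE.
apply: max_poly_roots nzD _ _; last by rewrite map_inj_uniq ?enum_uniq.
apply/allP => _ /imageP[l Gl ->]; apply/eqP.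
rewrite hornerD hornerN horner_sum (bigD1 l) //= hornerZ divfK; last first.
  by rewrite vanishing_poly_eq0 !inE eqxx.
rewrite big1 ?addr0 ?subrr // => i /andP[Gi nil].
have /eqP Mil : (M i).[t l] == 0 by rewrite vanishing_poly_eq0 !inE eq_sym nil.
by rewrite hornerZ Mil mulr0.
Qed.

End Vandermonde.

(** If a substitution is the identity modulo [Q] on variables, it is so on all
   polynomials.  When it also kills [Q], the quotient by [Q] embeds in the
   polynomial ring, and [Q] is prime. *)
Lemma congr_comp_mpoly (K : fieldType) n (Q : {mpoly K[n]} -> Prop)
    (h : 'I_n -> {mpoly K[n]}) :
  is_ideal Q -> (forall i, Q ('X_i - h i)) ->
  forall p, Q (p - (p \mPo [tuple h i | i < n])).
Proof.
move=> idQ Qh; have [Q0 QD QM] := idQ.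
have QMM p p' q q' : Q (p - p') -> Q (q - q') -> Q (p * q - p' * q').
  move=> Qp Qq; have -> : p * q - p' * q' = q * (p - p') + p' * (q - q') by ring.
  by apply: QD; apply: QM.
elim/mpolyind => [|c m p _ _ IHp]; first by rewrite comp_mpoly0 subr0.
rewrite comp_mpolyD comp_mpolyZ opprD addrACA -scalerBr; apply: QD => //.
apply: ideal_scale => //; rewrite comp_mpolyX mpolyXE_id.
elim/big_ind2: _ => [|p1 p2 q1 q2|i _]; first by rewrite subrr.
  exact: QMM.
rewrite tnth_mktuple; elim: (m i) => [|k IHk]; first by rewrite !expr0 subrr.
by rewrite !exprS; apply: QMM.
Qed.

(** * Shellings and regularity *)

(** Modulo the variables outside [F], the forms are linearly independent linear
   forms in the variables of [F], so the first [j] of them generate a prime ideal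
   that does not contain the next one.  The substitution [phi] that solves the
   first [j] equations for the variables of a [j]-element [G], by Lagrange
   interpolation at the nodes of [G], makes this explicit. *)
Lemma regular_seq_simplex (K : fieldType) n (t : 'I_n -> K) (F : {set 'I_n})
    (k : nat) :
  injective t -> (k <= #|F|)%N ->
  regular_seq (nonface_ideal (complex_gen [set F])) (vandermonde_form t) k.
Proof.
move=> t_inj lekF j p ltjk.
set I := nonface_ideal _; set theta := vandermonde_form t => Qp.
have idI : is_ideal I by apply/is_ideal_nonface/complex_gen_closed.
have idQ := is_ideal_adjoin theta j idI; have [Q0 QD QM] := idQ.
have I_F q : I q <-> (forall m, mnm_support m \subset F -> q@_m = 0).
  split=> Iq m Fm; apply: Iq; last first.
    by case/complex_genP: Fm => G /set1P->.
  by apply/complex_genP; exists F; rewrite ?inE.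
have ltjF : (j < #|F|)%N := leq_trans ltjk lekF.
have [G sGF cG] : exists2 G : {set 'I_n}, G \subset F & #|G| = j.
  exists [set x in take j (enum F)].
    by apply/subsetP => x; rewrite inE => /mem_take; rewrite mem_enum.
  rewrite cardsE (card_uniqP _) ?take_uniq ?enum_uniq // size_takel //.
  by rewrite -cardE ltnW.
pose M i := vanishing_poly t (G :\ i).
pose mu i l := (M i).[t l] / (M i).[t i].
have M0 i : (M i).[t i] != 0 by rewrite vanishing_poly_eq0 // !inE eqxx.
pose h i : {mpoly K[n]} :=
  if i \in G then - (\sum_(l in F :\: G) mu i l *: 'X_l)
  else if i \in F then 'X_i else 0.
pose phi p := p \mPo [tuple h i | i < n].
have split_form L : value_form t L = \sum_(i in G) L.[t i] *: 'X_i
    + \sum_(l in F :\: G) L.[t l] *: 'X_l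
    + \sum_(l | l \notin F) L.[t l] *: 'X_l.
  rewrite /value_form (bigID (mem G)) /= -addrA; congr (_ + _).
  rewrite (bigID (mem F)) /=; congr (_ + _); apply: eq_bigl => i.
    by rewrite !inE.
  by case: (boolP (i \in F)) => /=; rewrite ?andbF // andbT;
    move=> /(contra (subsetP sGF i)).
(* The form of [M i] expresses [x_i] modulo the ideal by the variables of
   [F :\: G], exactly as [h i] does. *)
have Qh i : adjoin I theta j ('X_i - h i).
  rewrite /h; case: ifP => [Gi|_]; last first.
    case: ifP => [_|/negbT nFi]; first by rewrite subrr.
    rewrite subr0; apply/adjoin_base/I_F => m sm; rewrite mcoeffX.
    by case: eqP sm => // <-; rewrite mnm_support1 sub1set (negPf nFi).
  have idS := ideal_scale (M i).[t i]^-1 idQ.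
  have -> : 'X_i - - (\sum_(l in F :\: G) mu i l *: 'X_l) =
     (M i).[t i]^-1 *: (value_form t (M i)
        - \sum_(l | l \notin F) (M i).[t l] *: 'X_l).
    rewrite split_form addrK scalerDr.
    rewrite [X in _ *: X + _](bigD1 i) //=.
    rewrite [X in _ *: (_ + X) + _]big1 ?addr0; last first.
      move=> l /andP[Gl nli]; suff /eqP-> : (M i).[t l] == 0 by rewrite scale0r.
      by rewrite vanishing_poly_eq0 // !inE nli.
    rewrite scalerA mulVf // scale1r opprK; congr (_ + _).
    by rewrite scaler_sumr; apply: eq_bigr => l _; rewrite scalerA mulrC.
  apply: idS; apply: is_idealB => //.
    apply: adjoin_value_form => //.
    by rewrite size_vanishing_poly (cardsD1 i G) Gi in cG *; rewrite -cG.
  apply: is_ideal_sum => // l nFl; apply: ideal_scale => //.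
  apply/adjoin_base/I_F => m sm; rewrite mcoeffX.
  by case: eqP sm => // <-; rewrite mnm_support1 sub1set (negPf nFl).
have phiX i : phi 'X_i = h i by rewrite /phi comp_mpolyXU -tnth_nth tnth_mktuple.
have phi_form L : phi (value_form t L) =
    \sum_(l in F :\: G) (L.[t l] - \sum_(i in G) L.[t i] * mu i l) *: 'X_l.
  rewrite /phi split_form !comp_mpolyD !raddf_sum /=.
  rewrite [X in _ + _ + X]big1 ?addr0; last first.
    move=> l nFl; rewrite comp_mpolyZ [_ \mPo _]phiX /h (negPf nFl).
    by rewrite (negPf (contra (subsetP sGF l) nFl)) scaler0.
  under eq_bigr => i Gi.
    rewrite comp_mpolyZ [_ \mPo _]phiX /h Gi scalerN scaler_sumr.
    under eq_bigr do rewrite scalerA.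
    over.
  under [X in _ + X]eq_bigr => l /setDP[Fl nGl].
    rewrite comp_mpolyZ [_ \mPo _]phiX /h (negPf nGl) Fl; over.
  rewrite sumrN exchange_big /= addrC -sumrB; apply: eq_bigr => l _.
  by rewrite scalerBl scaler_suml.
have phi_small (L : {poly K}) : (size L <= j)%N -> phi (value_form t L) = 0.
  move=> leLj; rewrite phi_form big1 // => l _.
  by rewrite (lagrange_interpolation t_inj (G := G)) ?cG // subrr scale0r.
have phiQ q : adjoin I theta j q -> phi q = 0.
  case=> a /I_F Iq.
  rewrite -[q](subrK (\sum_(i < j) theta i * a i)) /phi comp_mpolyD.
  rewrite [X in _ + X]raddf_sum /= [X in _ + X]big1 ?addr0; last first.
    move=> i _; rewrite rmorphM /= [X in X * _]phi_small ?mul0r //.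
    by rewrite size_polyXn.
  rewrite comp_mpolyEX big_seq big1 // => m; rewrite mcoeff_msupp => nzm.
  have /subsetPn[i mi nFi] : ~~ (mnm_support m \subset F).
    by apply: contraNN nzm => /Iq->.
  rewrite comp_mpolyX (bigD1 i) //= tnth_mktuple /h (negPf nFi).
  rewrite (negPf (contra (subsetP sGF i) nFi)) expr0n.
  by rewrite inE in mi; rewrite (negPf mi) mul0r scaler0.
(* [theta j] differs by earlier forms from the form of the monic polynomial that
   vanishes on [G], whose coefficients on [F :\: G] do not vanish. *)
have phi_theta : phi (theta j) != 0.
  pose V := vanishing_poly t G.
  have szV : size V = j.+1 by rewrite size_vanishing_poly cG.
  have -> : phi (theta j) = phi (value_form t V).
    rewrite (value_formE t (k := j.+1)) ?szV // big_ord_recr /=.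
    have -> : V`_j = 1.
      have /monicP := monic_prod_XsubC (enum (mem G)) predT t.
      by rewrite big_enum /= lead_coefE -/V szV.
    rewrite mulr1 /phi comp_mpolyD [X in _ = X + _]raddf_sum /=.
    rewrite [X in _ = X + _]big1 ?add0r // => i _.
    by rewrite rmorphM /= [X in X * _]phi_small ?mul0r // size_polyXn.
  have /subsetPn[l Fl nGl] : ~~ (F \subset G).
    by apply: contraL ltjF => /subset_leq_card; rewrite cG -leqNgt.
  rewrite phi_form; apply/eqP => /(congr1 (mcoeff U_(l)%MM)) /eqP.
  rewrite mcoeff0 raddf_sum /= (bigD1 l) /=; last by rewrite inE Fl nGl.
  rewrite mcoeffZ mcoeffX eqxx mulr1 [X in _ + X]big1 ?addr0; last first.
    move=> i /andP[_ nil]; rewrite mcoeffZ mcoeffX.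
    case: eqP => [/mnmP/(_ i)|]; last by rewrite mulr0.
    by rewrite !mnm1E eqxx eq_sym (negPf nil).
  rewrite big1 ?subr0 ?vanishing_poly_eq0 ?(negPf nGl) // => i Gi.
  suff /eqP-> : V.[t i] == 0 by rewrite mul0r.
  by rewrite vanishing_poly_eq0.
have /eqP : phi (theta j * p) = 0 by apply: phiQ.
rewrite [phi _]rmorphM /= mulf_eq0 [_ == 0](negPf phi_theta) /= => /eqP phip.
by have := congr_comp_mpoly idQ Qh p; rewrite phip subr0.
Qed.

(** A shelling order given by a rank [r] with possible ties; [R] plays the role of
   the restriction map.  Together the last two fields make the faces of
   [F] that lie in facets of smaller rank those not containing [R F]. *)
Record ranked_shelling n (Phi : {set {set 'I_n}}) (R : {set 'I_n} -> {set 'I_n})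
    (r : {set 'I_n} -> nat) : Prop := RankedShelling {
  restriction_sub : forall F, F \in Phi -> R F \subset F;
  restriction_rank : forall F G, F \in Phi -> G \in Phi -> F != G ->
    R F \subset G -> (r F < r G)%N;
  restriction_cover : forall F v, F \in Phi -> v \in R F ->
    exists G, [/\ G \in Phi, (r G < r F)%N & F :\ v \subset G] }.

Lemma ranked_shellingD1 n (Phi : {set {set 'I_n}}) R r (F : {set 'I_n}) :
  ranked_shelling Phi R r -> (forall G, G \in Phi -> (r G <= r F)%N) ->
  ranked_shelling (Phi :\ F) R r.
Proof.
move=> [subR rkR covR] maxF; split=> [G /setD1P[_]|G H /setD1P[_ PG] /setD1P[_]|].
- exact: subR.
- exact: rkR.
move=> G v /setD1P[_ PG] /covR-/(_ PG)[H [PH ltHG sGH]]; exists H; split=> //.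
rewrite !inE PH andbT; apply: contraTneq (leq_trans ltHG (maxF G PG)) => ->.
by rewrite ltnn.
Qed.

Lemma ranked_shelling_min n (Phi : {set {set 'I_n}}) R r (F s : {set 'I_n}) :
  ranked_shelling Phi R r -> F \in Phi -> s \subset F ->
  (forall G, G \in Phi -> (r G < r F)%N -> ~~ (s \subset G)) -> R F \subset s.
Proof.
move=> [_ _ covR] PF sF minF; apply/subsetP => v Rv; apply/negbNE/negP => nsv.
have [G [PG ltGF sFG]] := covR F v PF Rv.
have /negP[] := minF G PG ltGF; apply: subset_trans sFG.
by rewrite subsetD1 sF.
Qed.

Definition set_mnm n (A : {set 'I_n}) : 'X_{1..n} :=
  [multinom ((i \in A) : nat) | i < n].

Lemma mnm_support_set n (A : {set 'I_n}) : mnm_support (set_mnm A) = A.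
Proof. by apply/setP => i; rewrite inE mnmE eqb0 negbK. Qed.

Lemma set_mnm_le n (A : {set 'I_n}) (m : 'X_{1..n}) :
  A \subset mnm_support m -> (set_mnm A <= m)%MM.
Proof.
move=> sAm; apply/mnm_lepP => i; rewrite mnmE.
by case: (boolP (i \in A)) => // /(subsetP sAm); rewrite inE -lt0n.
Qed.

(** A shellable complex is Cohen-Macaulay: gluing on the last facet [F] of a
   shelling adds to the face ring the submodule generated by the monomial of the
   restriction of [F], which is a copy of the polynomial ring of [F]. *)
Lemma regular_seq_shelling (K : fieldType) n (t : 'I_n -> K)
    (Phi : {set {set 'I_n}}) R r (k : nat) :
  injective t -> ranked_shelling Phi R r ->
  (forall F, F \in Phi -> (k <= #|F|)%N) ->
  regular_seq (nonface_ideal (complex_gen Phi)) (vandermonde_form t) k.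
Proof.
move=> t_inj; have [N] := ubnP #|Phi|.
elim: N Phi => // N IHN Phi ltPhiN shPhi dimPhi.
have [-> j p ltjk _|[F0 PF0]] := set_0Vmem Phi.
  by apply: adjoin_base => m /complex_genP[G]; rewrite inE.
have [F PF maxF] : exists2 F, F \in Phi & forall G, G \in Phi -> (r G <= r F)%N.
  by case: (arg_maxnP r PF0) => F; exists F.
have shPsi := ranked_shellingD1 shPhi maxF.
have [subR rkR covR] := shPhi.
(* With [F] of maximal rank, [R F] is a new face. *)
have nRF : R F \notin complex_gen (Phi :\ F).
  apply/complex_genP => -[G /setD1P[nGF PG] sRG].
  have := rkR F G PF PG; rewrite eq_sym => /(_ nGF sRG).
  by rewrite ltnNge maxF.
have id_nf S : is_ideal (@nonface_ideal K n (complex_gen S)).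
  exact/is_ideal_nonface/complex_gen_closed.
apply: (@regular_seq_extension _ _ (nonface_ideal (complex_gen (Phi :\ F)))
  (nonface_ideal (complex_gen [set F])) 'X_[set_mnm (R F)]).
- exact: id_nf.
- exact: id_nf.
- by apply: nonface_idealX; rewrite mnm_support_set.
- move=> p Ip m /complex_genP[G /setD1P[_ PG] sG].
  by apply: Ip; apply/complex_genP; exists G.
- move=> p Ip.
  exists (\sum_(m <- msupp p | R F \subset mnm_support m)
     p@_m *: 'X_[m - set_mnm (R F)]).
  rewrite {1}[p]mpolyE (bigID (fun m => R F \subset mnm_support m)) /=.
  rewrite [X in X + _ - _](_ : _ = 'X_[set_mnm (R F)] *
    \sum_(m <- msupp p | R F \subset mnm_support m)
       p@_m *: 'X_[m - set_mnm (R F)]); last first.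
    rewrite mulr_sumr; apply: eq_bigr => m sRm.
    by rewrite -scalerAr -mpolyXD addmC submK // set_mnm_le.
  rewrite addrC addKr big_seq_cond; apply: is_ideal_sum => //.
  move=> m /andP[pm nRm]; apply: (ideal_scale _ (id_nf Phi)).
  apply: nonface_idealX; apply/complex_genP => -[G PG smG].
  have := pm; rewrite mcoeff_msupp Ip ?eqxx //.
  have [eGF|nGF] := eqVneq G F; last first.
    by apply/complex_genP; exists G; rewrite // !inE nGF.
  apply/negbNE/negP => nPsi; case/negP: nRm.
  apply: (ranked_shelling_min shPhi PF); first by rewrite -eGF.
  move=> H PH ltHF; apply: contra nPsi => smH; apply/complex_genP; exists H => //.
  by rewrite !inE PH andbT; apply: contraTneq ltHF => ->; rewrite ltnn.
- move=> q; rewrite mulrC; split=> Iq m.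
    case/complex_genP=> G /set1P-> smF; rewrite -(mcoeffMX q (set_mnm (R F)) m).
    apply: Iq; apply/complex_genP; exists F => //.
    by rewrite mnm_supportD mnm_support_set subUset smF subR.
  case/complex_genP=> G PG smG; apply: memN_msupp_eq0; apply/negP.
  rewrite (perm_mem (msuppMX _ _)) => /mapP[m' qm' em]; move: qm'.
  rewrite mcoeff_msupp Iq ?eqxx //; apply/complex_genP; exists F; first exact/set1P.
  move: smG; rewrite em mnm_supportD mnm_support_set subUset => /andP[sRG sm'G].
  suff <- : G = F by [].
  apply/eqP/negbNE/negP => nGF; case/negP: nRF; apply/complex_genP.
  by exists G; rewrite // !inE nGF.
- apply: IHN => //; first by move: ltPhiN; rewrite (cardsD1 F) PF.
  by move=> G /setD1P[_ /dimPhi].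
- by apply: regular_seq_simplex => //; apply: dimPhi.
Qed.

(** * Straightening monomials modulo the linear forms *)

(** The slack [#|A| < mdeg m] provides a variable that is either outside [A] or
   occurs twice, so that the support of the cofactor still contains [A]. *)
Lemma mnm_split_off n (A : {set 'I_n}) (m : 'X_{1..n}) :
  A \subset mnm_support m -> (#|A| < mdeg m)%N ->
  exists i c, m = (U_(i) + c)%MM /\ A \subset mnm_support c.
Proof.
move=> sAm ltAm.
have [i lti] : exists i, ((i \in A) < m i)%N.
  apply/existsP; apply: contraLR ltAm; rewrite negb_exists => /forallP small.
  rewrite -leqNgt mdegE -sum1_card [leqRHS]big_mkcond /=.
  by apply: leq_sum => i _; have := small i; rewrite -leqNgt; case: (i \in A).
exists i, (m - U_(i))%MM; split.
  rewrite addmC submK //; apply/mnm_lepP => j; rewrite mnm1E.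
  by case: eqP => // <-; apply: leq_ltn_trans lti.
apply/subsetP => j Aj; rewrite inE mnmBE mnm1E.
have := subsetP sAm j Aj; rewrite inE.
case: (eqVneq i j) => [ij|_]; last by rewrite subn0.
by move: Aj lti; rewrite -ij => ->; lia.
Qed.

(** Trading one variable of a monomial supported on [F] for variables outside [F]
   keeps the degree and lets the support leave [F] while still containing [A]. *)
Lemma straighten (K : fieldType) n (t : 'I_n -> K) (I : {mpoly K[n]} -> Prop)
    (k : nat) (A F : {set 'I_n}) (m : 'X_{1..n}) :
  injective t -> is_ideal I -> (#|F| <= k)%N ->
  A \subset mnm_support m -> mnm_support m \subset F -> (#|A| < mdeg m)%N ->
  (forall m' l, mdeg m' = mdeg m -> l \notin F ->
     l |: A \subset mnm_support m' -> adjoin I (vandermonde_form t) k 'X_[m']) ->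
  adjoin I (vandermonde_form t) k 'X_[m].
Proof.
move=> t_inj idI leFk sAm smF ltAm Qm'.
have [i [c [em sAc]]] := mnm_split_off sAm ltAm.
rewrite em mpolyXD; apply: (vandermonde_eliminate t_inj idI leFk).
  by apply: (subsetP smF); rewrite em mnm_supportD mnm_support1 !inE eqxx.
move=> l nFl; rewrite -mpolyXD; apply: (Qm' _ l) => //.
  by rewrite em !mdegD !mdeg1.
by rewrite mnm_supportD mnm_support1 setUS.
Qed.

(** Let [F] be the first facet containing the support of [m]; then [R F] lies in
   the support.  Straightening with [A = R F] gives monomials whose support
   contains [R F] and is not in [F], so only later facets can contain it, and the
   process ends at non-faces. *)
Lemma shelling_high_degree (K : fieldType) n (t : 'I_n -> K)
    (Phi : {set {set 'I_n}}) R r (k D : nat) (m : 'X_{1..n}) :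
  injective t -> ranked_shelling Phi R r ->
  (forall F, F \in Phi -> (#|F| <= k)%N) ->
  (forall F, F \in Phi -> (#|R F| <= D)%N) -> (D < mdeg m)%N ->
  adjoin (nonface_ideal (complex_gen Phi)) (vandermonde_form t) k 'X_[m].
Proof.
move=> t_inj shPhi dimPhi dimR.
have idI : is_ideal (@nonface_ideal K n (complex_gen Phi)).
  exact/is_ideal_nonface/complex_gen_closed.
pose B := (\max_(F in Phi) r F)%N.
suff main s : forall m, (D < mdeg m)%N ->
    (forall F, F \in Phi -> mnm_support m \subset F -> (B < r F + s)%N) ->
    adjoin (nonface_ideal (complex_gen Phi)) (vandermonde_form t) k 'X_[m].
  by move=> ltDm; apply: (main B.+1) => // F _ _; rewrite addnS ltnS leq_addl.
elim: s => [|s IHs] {}m ltDm rk.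
  apply/adjoin_base/nonface_idealX/complex_genP => -[F PF /(rk F PF)].
  by rewrite addn0 ltnNge (leq_bigmax_cond F).
have [/complex_genP[F0 PF0 sF0]|nm] := boolP (mnm_support m \in complex_gen Phi);
  last exact/adjoin_base/nonface_idealX.
have [F /andP[PF smF] minF] := arg_minnP (P := [pred F |
  (F \in Phi) && (mnm_support m \subset F)]) r (introT andP (conj PF0 sF0)).
have sRm : R F \subset mnm_support m.
  apply: (ranked_shelling_min shPhi) => // G PG; apply: contraL => smG.
  by rewrite -leqNgt minF //= PG.
apply: (straighten t_inj idI (dimPhi F PF) sRm smF).
  exact: leq_ltn_trans (dimR F PF) ltDm.
move=> m' l em' nFl; rewrite subUset sub1set => /andP[lm' sRm'].
apply: IHs; rewrite ?em' // => G PG sm'G.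
have ltFG : (r F < r G)%N.
  apply: (restriction_rank shPhi) => //; last exact: subset_trans sm'G.
  by apply: contraNneq nFl => ->; apply: (subsetP sm'G).
by have := rk F PF smF; lia.
Qed.

(** Straightening with [A] and [F] both equal to the support enlarges the support
   until it is not a face; this is the Kind-Kleinschmidt criterion for linear
   systems of parameters, made effective. *)
Lemma complex_high_degree (K : fieldType) n (t : 'I_n -> K)
    (Gamma : {set {set 'I_n}}) (k : nat) (m : 'X_{1..n}) :
  injective t -> subset_closed Gamma ->
  (forall F, F \in Gamma -> (#|F| <= k)%N) -> (k < mdeg m)%N ->
  adjoin (nonface_ideal Gamma) (vandermonde_form t) k 'X_[m].
Proof.
move=> t_inj clG dimG; have idI := @is_ideal_nonface K n _ clG.
have [s] := ubnP (n - #|mnm_support m|); elim: s m => // s IHs m lts ltkm.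
have [Gm|nm] := boolP (mnm_support m \in Gamma);
  last exact/adjoin_base/nonface_idealX.
apply: (straighten t_inj idI (dimG _ Gm) (subxx _) (subxx _)).
  exact: leq_ltn_trans (dimG _ Gm) ltkm.
move=> m' l em' nml sm'; apply: IHs; last by rewrite em'.
have lem'n : (#|mnm_support m'| <= n)%N by rewrite -[leqRHS]card_ord max_card.
have ltmm' : (#|mnm_support m| < #|mnm_support m'|)%N.
  by apply: leq_trans (subset_leq_card sm'); rewrite cardsU1 nml.
rewrite ltnS in lts; apply: leq_trans lts.
by rewrite ltn_sub2l // (leq_trans ltmm').
Qed.

(** * The boundary of a shelled ball with small restrictions *)

Section Boundary.

Variables (n d : nat) (Phi : {set {set 'I_n}}).
Variables (R : {set 'I_n} -> {set 'I_n}) (r : {set 'I_n} -> nat).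
Hypothesis shPhi : ranked_shelling Phi R r.
Hypothesis dimPhi : forall F, F \in Phi -> #|F| = d.+1.
Hypothesis dimR : forall F, F \in Phi -> (#|R F| <= d./2)%N.

Local Notation S := (ball_boundary d (complex_gen Phi)).

Lemma facets_complex_gen : facets (complex_gen Phi) = Phi.
Proof.
apply/setP => F; rewrite inE; apply/maxsetP/idP => [[/complex_genP[G PG sFG] mx]|PF].
  by rewrite -(mx G _ sFG) //; apply/complex_genP; exists G.
split=> [|G /complex_genP[H PH sGH] sFG]; first by apply/complex_genP; exists F.
by apply/eqP; rewrite eq_sym eqEcard sFG (dimPhi PF) -(dimPhi PH) subset_leq_card.
Qed.

Lemma ball_boundary_sub F : F \in S -> F \in complex_gen Phi.
Proof.
case/complex_genP=> G; rewrite inE facets_complex_gen => /andP[_ /cards1P[H eH]] sFG.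
have : H \in [set H] by rewrite inE.
rewrite -eH inE => /andP[PH sGH].
by apply/complex_genP; exists H => //; apply: subset_trans sGH.
Qed.

Lemma ball_boundary_card F : F \in S -> (#|F| <= d)%N.
Proof.
by case/complex_genP=> G; rewrite inE => /andP[/eqP <- _] /subset_leq_card.
Qed.

(** If [F] is the last facet containing [s] and [v] is a vertex of [F] outside
   [s] and the restriction, no other facet contains [F :\ v]: an earlier one by
   the choice of [v], a later one by the choice of [F].  Hence an interior face
   contains the complement of a restriction, and is large. *)
Lemma ball_boundary_small s :
  s \in complex_gen Phi -> (#|s| <= d./2)%N ->
  exists G, [/\ G \in S, #|G| = d & s \subset G].
Proof.
case: shPhi => _ rkR _.
case/complex_genP=> F0 PF0 sF0 small.
have [F /andP[PF sF] maxF] := arg_maxnP (P := [pred F |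
  (F \in Phi) && (s \subset F)]) r (introT andP (conj PF0 sF0)).
have /subsetPn[v Fv] : ~~ (F \subset R F :|: s).
  apply/negP => /subset_leq_card; rewrite dimPhi // => le_d.
  have := leq_trans le_d (leq_card_setU _ _).1; rewrite ltnNge => /negP[].
  rewrite (leq_trans (leq_add (dimR PF) small)) // addnn.
  by rewrite -[leqRHS]odd_double_half leq_addl.
rewrite inE negb_or => /andP[nRv nsv].
have sRF : R F \subset F :\ v.
  by rewrite subsetD1 (restriction_sub shPhi).
have cG : #|F :\ v| = d by apply/eqP; rewrite -eqSS -(dimPhi PF) (cardsD1 v F) Fv.
exists (F :\ v); rewrite cG subsetD1 sF; split=> //.
apply/complex_genP; exists (F :\ v) => //; rewrite inE cG eqxx /=.
apply/cards1P; exists F; rewrite facets_complex_gen.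
apply/setP => G; rewrite !inE; apply/andP/eqP => [[PG sFG]|-> {G}]; last first.
  by rewrite subD1set.
apply/eqP/negbNE/negP; rewrite eq_sym => nFG.
have := rkR F G PF PG nFG (subset_trans sRF sFG); rewrite ltnNge => /negP[].
by apply: maxF; rewrite /= PG (subset_trans _ sFG) // subsetD1 sF.
Qed.

Lemma complex_rank_ball_boundary F : F \in Phi -> complex_rank S = d.
Proof.
move=> PF; apply/eqP; rewrite eqn_leq; apply/andP; split.
  by apply/bigmax_leqP => G; apply: ball_boundary_card.
have [||G [SG cG _]] := @ball_boundary_small set0; rewrite ?cards0 //.
  by apply/complex_genP; exists F; rewrite ?sub0set.
by rewrite -[leqLHS]cG /complex_rank (bigmax_sup G).
Qed.

End Boundary.

(** * Graded pieces *)

Lemma mcoeff_pihomog (K : fieldType) n i (p : {mpoly K[n]}) m :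
  (pihomog mdeg i p)@_m = if mdeg m == i then p@_m else 0.
Proof.
elim/mpolyind: p => [|c m' p _ _ IHp]; first by rewrite raddf0 !mcoeff0 if_same.
rewrite linearP /= !mcoeffD !mcoeffZ IHp pihomogX mcoeffX.
have [<-|nm] := eqVneq m' m.
  by case: ifP => _; rewrite ?mcoeffX ?mcoeff0 ?eqxx ?mulr0 ?addr0.
rewrite mulr0 !add0r; case: ifP => _; rewrite ?mcoeffX ?mcoeff0 ?(negPf nm);
  by rewrite mulr0 add0r.
Qed.

Lemma pihomog_linear_form (K : fieldType) n i (w p : {mpoly K[n]}) :
  w \is 1.-homog -> pihomog mdeg i.+1 (w * p) = w * pihomog mdeg i p.
Proof.
move=> w1; elim/mpolyind: p => [|c m p _ _ IHp]; first by rewrite mulr0 !raddf0 mulr0.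
rewrite mulrDr -scalerAr !linearP /= mulrDr -scalerAr -IHp; congr (_ *: _ + _).
have wX : w * 'X_[m] \is (mdeg m).+1.-homog.
  by rewrite -add1n; apply: dhomogM; rewrite // dhomogX.
rewrite pihomogX; case: eqP => [<-|/eqP nm]; first exact: pihomog_dE.
by rewrite mulr0; apply: pihomog_ne0 wX; rewrite eqSS.
Qed.

Lemma nonface_ideal_pihomog (K : fieldType) n (Gamma : {set {set 'I_n}}) i
    (p : {mpoly K[n]}) :
  nonface_ideal Gamma p -> nonface_ideal Gamma (pihomog mdeg i p).
Proof. by move=> Ip m Gm; rewrite mcoeff_pihomog Ip // if_same. Qed.

(** A monomial of degree [i] has at most [i] vertices in its support, so complexes
   with the same faces of size at most [i] have the same ideal in degree [i]. *)
Lemma nonface_ideal_low_degree (K : fieldType) n (B S : {set {set 'I_n}}) i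
    (p : {mpoly K[n]}) :
  (forall F, F \in B -> (#|F| <= i)%N -> F \in S) ->
  p \is i.-homog -> nonface_ideal S p -> nonface_ideal B p.
Proof.
move=> BS homp Ip m Bm; have [em|nm] := eqVneq (mdeg m) i; last first.
  exact: dhomog_nemf_coeff homp nm.
apply/Ip/BS => //; rewrite -em mdegE -sum1_card big_mkcond /=.
by apply: leq_sum => j _; rewrite inE; case: (m j).
Qed.

(** The ideals involved are graded, so membership of a form has a graded witness;
   this lets degree arguments be applied to the non-face part. *)
Lemma adjoin_homog (K : fieldType) n (Gamma : {set {set 'I_n}})
    (theta : nat -> {mpoly K[n]}) (k i : nat) (p : {mpoly K[n]}) :
  (forall j, theta j \is 1.-homog) -> p \is i.+1.-homog ->
  adjoin (nonface_ideal Gamma) theta k p ->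
  exists a : nat -> {mpoly K[n]}, [/\ forall j, a j \is i.-homog,
    nonface_ideal Gamma (p - \sum_(j < k) theta j * a j) &
    p - \sum_(j < k) theta j * a j \is i.+1.-homog].
Proof.
move=> theta1 homp [a Ia]; exists (fun j => pihomog mdeg i (a j)).
have e : p - \sum_(j < k) theta j * pihomog mdeg i (a j) =
    pihomog mdeg i.+1 (p - \sum_(j < k) theta j * a j).
  rewrite raddfB [X in _ = _ - X]raddf_sum /= pihomog_dE //; congr (_ - _).
  by apply: eq_bigr => j _; rewrite pihomog_linear_form.
split=> [j||]; first exact: pihomogP.
- by rewrite e; apply: nonface_ideal_pihomog.
by rewrite e; apply: pihomogP.
Qed.

(** * Generated ideals *)

Lemma ideal_gen_base (R : comNzRingType) (S : R -> Prop) p :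
  S p -> ideal_gen S p.
Proof.
move=> Sp; exists [:: (1, p)]; rewrite big_seq1 mul1r; split=> // cg.
by rewrite inE => /eqP->.
Qed.

Lemma is_ideal_gen (R : comNzRingType) (S : R -> Prop) : is_ideal (ideal_gen S).
Proof.
split=> [|p q [s [Ss ->]] [s' [Ss' ->]]|a p [s [Ss ->]]].
- by exists [::]; rewrite big_nil.
- exists (s ++ s'); rewrite big_cat; split=> // cg.
  by rewrite mem_cat => /orP[/Ss|/Ss'].
exists [seq (a * cg.1, cg.2) | cg <- s]; split=> [_ /mapP[cg /Ss Scg ->] //|].
by rewrite big_map mulr_sumr; apply: eq_bigr => cg _; rewrite mulrA.
Qed.

Lemma ideal_gen_sub (R : comNzRingType) (S I : R -> Prop) p :
  is_ideal I -> (forall q, S q -> I q) -> ideal_gen S p -> I p.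
Proof.
move=> idI SI [s [Ss ->]]; rewrite big_seq; apply: is_ideal_sum => // cg /Ss/SI.
by case: idI => _ _; apply.
Qed.

Lemma set_mnmE (K : fieldType) n (F : {set 'I_n}) :
  'X_[set_mnm F] = \prod_(i in F) 'X_i :> {mpoly K[n]}.
Proof.
rewrite mpolyXE_id [RHS]big_mkcond; apply: eq_bigr => i _.
by rewrite mnmE; case: (i \in F); rewrite ?expr1 ?expr0.
Qed.

Lemma stanley_reisner_nonface (K : fieldType) n (Gamma : {set {set 'I_n}})
    (p : {mpoly K[n]}) :
  subset_closed Gamma -> stanley_reisner_ideal Gamma p <-> nonface_ideal Gamma p.
Proof.
move=> clG; split.
  apply: ideal_gen_sub; first exact: is_ideal_nonface.
  move=> _ [F nF ->]; rewrite -set_mnmE; apply: nonface_idealX.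
  by rewrite mnm_support_set.
move=> Ip; apply: ideal_of_monomials; first exact: is_ideal_gen.
move=> m; rewrite mcoeff_msupp => nzm.
have nGm : mnm_support m \notin Gamma by apply: contraNN nzm => /Ip->.
have lem : (set_mnm (mnm_support m) <= m)%MM by apply: set_mnm_le.
rewrite -(submK lem) mpolyXD; have [_ _] := is_ideal_gen (fun q : {mpoly K[n]} =>
  exists2 F : {set 'I_n}, F \notin Gamma & q = \prod_(i in F) 'X_i).
apply; apply: ideal_gen_base; exists (mnm_support m) => //; exact: set_mnmE.
Qed.

Lemma reduction_idealP (K : fieldType) n (Gamma : {set {set 'I_n}}) d
    (theta : nat -> {mpoly K[n]}) p :
  subset_closed Gamma ->
  reduction_ideal Gamma (fun i : 'I_d => theta i) p <->
  adjoin (nonface_ideal Gamma) theta d p.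
Proof.
move=> clG; have idI := @is_ideal_nonface K n _ clG; split.
  apply: ideal_gen_sub; first exact: is_ideal_adjoin.
  move=> q [/(stanley_reisner_nonface _ clG)|[i ->]]; first exact: adjoin_base.
  by apply: adjoin_gen.
have idG := is_ideal_gen (fun q =>
  stanley_reisner_ideal Gamma q \/ exists i : 'I_d, q = theta i).
have [_ GD GM] := idG.
case=> a /(stanley_reisner_nonface _ clG) SRp.
rewrite -[p](subrK (\sum_(i < d) theta i * a i)); apply: GD.
  by apply: ideal_gen_base; left.
apply: is_ideal_sum => // i _; rewrite mulrC; apply: GM.
by apply: ideal_gen_base; right; exists i.
Qed.

(** * The weak Lefschetz property *)

Lemma infinite_type_injection (T : eqType) n :
  infinite_type T -> exists t : 'I_n -> T, injective t.
Proof.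
move=> infT; have [s us es] : exists2 s : seq T, uniq s & size s = n.
  elim: n => [|n [s us <-]]; first by exists [::].
  by have [x nsx] := infT s; exists (x :: s) => //=; rewrite nsx.
case: n es => [|n] es; first by have [x _] := infT [::]; exists (fun=> x) => -[].
have [x _] := infT [::]; exists (fun i => nth x s i) => i j /eqP.
by rewrite nth_uniq ?es // => /eqP/val_inj.
Qed.

(** Injectivity is computed in the face ring of the ball and descends because the
   two rings agree in low degrees; surjectivity descends because the face ring of
   the boundary is a quotient. *)
Lemma weak_lefschetz_shelled (K : fieldType) n d (Phi : {set {set 'I_n}}) R r :
  infinite_type K -> ranked_shelling Phi R r -> Phi != set0 ->
  (forall F, F \in Phi -> #|F| = d.+1) ->
  (forall F, F \in Phi -> (#|R F| <= d./2)%N) ->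
  weak_lefschetz K (ball_boundary d (complex_gen Phi)).
Proof.
move=> infK shPhi /set0Pn[F0 PF0] dimPhi dimR.
have [t t_inj] := infinite_type_injection n infK.
set B := complex_gen Phi; set S := ball_boundary d B.
have clB : subset_closed B by apply: complex_gen_closed.
have clS : subset_closed S by apply: complex_gen_closed.
have sSB := ball_boundary_sub dimPhi.
have rkS : complex_rank S = d := complex_rank_ball_boundary shPhi dimPhi dimR PF0.
pose theta := vandermonde_form t.
have theta1 j : theta j \is 1.-homog by apply: value_form_homog.
have idB := @is_ideal_nonface K n _ clB.
have idS := @is_ideal_nonface K n _ clS.
have JP p := @reduction_idealP K n S (complex_rank S) theta p clS.
have BS (p : {mpoly K[n]}) : nonface_ideal B p -> nonface_ideal S p.
  by move=> Bp m /sSB; apply: Bp.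
exists (fun i => theta i), (theta d) => /=; split=> //.
- split=> [i //|].
  pose ms := [seq bmnm m | m <- enum {: 'X_{1..n < d.+1}}].
  exists [seq 'X_[m] | m <- ms] => p; exists (fun j => p@_(nth 0%MM ms j)).
  apply/JP; rewrite rkS.
  set q := \sum_(j < _) _.
  have eq_q : q = \sum_(m : 'X_{1..n < d.+1}) p@_m *: 'X_[m].
    transitivity (\sum_(m <- ms) p@_m *: ('X_[m] : {mpoly K[n]})).
      have sz := size_map (fun m => 'X_[m] : {mpoly K[n]}) ms.
      rewrite (big_nth 0%MM) big_mkord -sz; apply: eq_bigr => j _.
      by rewrite (nth_map 0%MM) // -sz.
    by rewrite big_map big_enum.
  apply: ideal_of_monomials; first exact: is_ideal_adjoin.
  move=> m; rewrite mcoeff_msupp mcoeffB eq_q => nzm.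
  apply: complex_high_degree => //; first exact: ball_boundary_card.
  rewrite ltnNge; apply: contraNN nzm => lemd.
  by rewrite (mcoeff_mpoly (fun m => p@_m)) // subrr.
- case=> // i /= leid f g homf homg /JP Jw; rewrite rkS in leid.
  rewrite rkS -mulrBr in Jw.
  have homfg : f - g \is i.-homog by apply: rpredB.
  apply/JP; rewrite rkS.
  have homw : theta d * (f - g) \is i.+1.-homog by rewrite -add1n; apply: dhomogM.
  have [a [_ Sa homa]] := adjoin_homog theta1 homw Jw.
  have Ba : adjoin (nonface_ideal B) theta d (theta d * (f - g)).
    exists a; apply: nonface_ideal_low_degree homa Sa => F BF leFi.
    have [|G [SG _ sFG]] := ball_boundary_small shPhi dimPhi dimR BF.
      exact: leq_trans leFi leid.
    exact: clS sFG SG.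
  have reg : regular_seq (nonface_ideal B) theta d.+1.
    by apply: regular_seq_shelling shPhi _ => // F PF; rewrite dimPhi.
  by have [c Bc] := reg d _ (ltnSn d) Ba; exists c; apply: BS.
- case=> // i ltdi g homg; rewrite rkS in ltdi.
  have Bg : adjoin (nonface_ideal B) theta d.+1 g.
    apply: ideal_of_monomials; first exact: is_ideal_adjoin.
    move=> m gm; apply: (shelling_high_degree t_inj shPhi _ dimR).
      by move=> F PF; rewrite dimPhi.
    by rewrite (dhomog_mf homg gm).
  have [a [homa Ba _]] := adjoin_homog theta1 homg Bg.
  exists (a d) => //; apply/JP; rewrite rkS; exists (fun j => 0 + (-1) * a j).
  rewrite (sum_mulD theta (fun=> 0) a) big1 ?add0r => [|j _]; last by rewrite mulr0.
  rewrite big_ord_recr /= in Ba; set A := \sum_(j < d) _ in Ba *.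
  have -> : theta d * a d - g - -1 * A = -1 * (g - (A + theta d * a d)) by ring.
  by case: idS => _ _; apply; apply: BS.
Qed.

(** * Staircases *)

(** [a] encodes a monomial of degree at most [D] in [M.-1] variables, padded
   with the index [M], which stands for the factor 1. *)
Definition staircase (M D : nat) (a : nat -> nat) : Prop :=
  [/\ forall p q, (p <= q)%N -> (a p <= a q)%N, forall p, (0 < a p <= M)%N
    & forall p, (D <= p)%N -> a p = M].

(** The pair [{a p + 2 p, a p + 2 p + 1}] comes from [t = p.*2] and
   [t = p.*2.+1].  As vertices are numbered from 1, [v : 'I_n] is vertex [v.+1]. *)
Definition staircase_facet n d (a : nat -> nat) : {set 'I_n} :=
  [set v : 'I_n | [exists t : 'I_d.+1, v.+1 == a t./2 + t]]%N.

Definition staircase_restriction n M D (a : nat -> nat) : {set 'I_n} :=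
  [set v : 'I_n | [exists p : 'I_D, (a p < M) && (v.+1 == a p + p.*2)]]%N.

Definition staircase_rank M D (a : nat -> nat) : nat :=
  (\sum_(p < D) (M - a p))%N.

Definition raise (a : nat -> nat) (p q : nat) : nat :=
  (a q + ((p <= q) && (a q == a p)))%N.

Lemma double_ltn_half p d : (p < d./2)%N -> (p.*2 < d)%N.
Proof. by move=> ltpd; rewrite -(odd_double_half d); lia. Qed.

Section Staircase.

Variables (n d M : nat).

Local Notation D := d./2.
Local Notation facet := (@staircase_facet n d).
Local Notation restriction := (@staircase_restriction n M D).
Local Notation rank := (staircase_rank M D).

Local Open Scope nat_scope.

Implicit Types (a b : nat -> nat) (v : 'I_n).

Lemma staircase_facetP a v :
  reflect (exists2 t, t <= d & v.+1 = a t./2 + t) (v \in facet a).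
Proof.
rewrite inE; apply: (iffP existsP) => [[t /eqP e]|[t letd e]].
  by exists t; rewrite // -ltnS.
by exists (inord t); rewrite inordK ?e.
Qed.

Lemma staircase_restrictionP a v :
  reflect (exists p, [/\ p < D, a p < M & v.+1 = a p + p.*2])
    (v \in restriction a).
Proof.
rewrite inE; apply: (iffP existsP) => [[p /andP[lt /eqP e]]|[p [ltpD lt e]]].
  by exists p.
by exists (Ordinal ltpD); rewrite lt e eqxx.
Qed.

Lemma staircase_strict a t t' : staircase M D a ->
  t < t' -> a t./2 + t < a t'./2 + t'.
Proof.
case=> mono _ _ lttt'; rewrite -addnS leq_add // mono //.
exact/half_leq/ltnW.
Qed.

Lemma staircase_mono a t t' : staircase M D a ->
  t <= t' -> a t./2 + t <= a t'./2 + t'.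
Proof. by case=> mono _ _ lett'; rewrite leq_add // mono // half_leq. Qed.

Lemma staircase_facet_card a :
  n = M + d -> staircase M D a -> #|facet a| = d.+1.
Proof.
move=> nE sa; have [mono bnd stab] := sa.
have lt_n (t : 'I_d.+1) : (a t./2 + t).-1 < n.
  have := staircase_mono sa (ltn_ord t : t <= d).
  by rewrite (stab D) // -nE; have := bnd t./2; lia.
pose f (t : 'I_d.+1) := Ordinal (lt_n t).
have fE t : (f t).+1 = a t./2 + t by rewrite /f /=; have := bnd t./2; lia.
have -> : facet a = f @: setT.
  apply/setP => v; rewrite inE; apply/existsP/imsetP => [[t /eqP e]|[t _ ->]].
    by exists t; rewrite ?inE //; apply/val_inj/eq_add_S; rewrite e fE.
  by exists t; rewrite fE.
rewrite card_imset ?cardsT ?card_ord // => t t' /(congr1 (fun v => v.+1)).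
rewrite !fE => e; apply/val_inj; case: (ltngtP t t') => // /(staircase_strict sa).
  by rewrite e ltnn.
by rewrite e ltnn.
Qed.

Lemma staircase_restriction_sub a : restriction a \subset facet a.
Proof.
apply/subsetP => v /staircase_restrictionP[p [ltpD _ e]].
apply/staircase_facetP; exists p.*2; last by rewrite doubleK.
exact/ltnW/double_ltn_half.
Qed.

Lemma staircase_restriction_card a : #|restriction a| <= D.
Proof.
rewrite cardE -(size_map (fun v => v.+1)) -[leqRHS](size_iota 0).
rewrite -[leqRHS](size_map (fun p => a p + p.*2)); apply: uniq_leq_size.
  have inj : injective (fun v : 'I_n => v.+1) by move=> v v' [] /val_inj.
  by rewrite (map_inj_uniq inj) enum_uniq.
move=> x /mapP[v]; rewrite mem_enum => /staircase_restrictionP[p [ltpD _ e]] ->.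
by apply/mapP; exists p; rewrite // mem_iota.
Qed.

(** Successive vertices [a p + 2 p] differ by at least two, while each pair
   [{b q + 2 q, b q + 2 q + 1}] spans one unit: by induction the [p]-th vertex
   lies in the [p]-th pair of [b] or a later one. *)
Lemma staircase_restriction_le a b :
  n = M + d -> staircase M D a -> staircase M D b ->
  restriction a \subset facet b -> forall p, b p <= a p.
Proof.
move=> nE sa sb sub; have [monoa bnda staba] := sa; have [monob bndb stabb] := sb.
have main p : p < D -> a p < M ->
    exists t, p.*2 <= t /\ a p + p.*2 = b t./2 + t.
  have pos q : q < D -> a q < M -> exists t, a q + q.*2 = b t./2 + t.
    move=> ltqD ltaM; have lt_n : (a q + q.*2).-1 < n.
      by rewrite nE; have := double_ltn_half ltqD; have := bnda q; lia.
    have e : (Ordinal lt_n).+1 = a q + q.*2 by rewrite /=; have := bnda q; lia.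
    have : Ordinal lt_n \in restriction a.
      by apply/staircase_restrictionP; exists q.
    by move=> /(subsetP sub)/staircase_facetP[t _ et]; exists t; rewrite -e.
  elim: p => [|p IHp] ltpD ltaM.
    by have [t et] := pos 0 ltpD ltaM; exists t.
  have lea : a p <= a p.+1 by apply: monoa.
  have [t [let2 et]] := IHp (ltnW ltpD) (leq_ltn_trans lea ltaM).
  have [t' et'] := pos p.+1 ltpD ltaM; exists t'; split=> //.
  rewrite leqNgt; apply/negP => ltt'.
  have le1 := staircase_mono sb (_ : t' <= p.*2.+1).
  have {}le1 : b t'./2 + t' <= b p.*2.+1./2 + p.*2.+1.
    by apply: le1; rewrite doubleS in ltt'.
  have le2 := staircase_mono sb let2.
  have eh : p.*2.+1./2 = p by rewrite /= uphalf_double.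
  by rewrite eh in le1; rewrite doubleK in le2; rewrite doubleS in et'; lia.
move=> p; have [leDp|ltpD] := leqP D p; first by rewrite stabb // staba.
have [/andP[_ leM] /andP[_ leM']] := (bnda p, bndb p).
move: leM; rewrite leq_eqVlt => /orP[/eqP-> //|ltM].
have [t [let2 et]] := main p ltpD ltM.
by have := staircase_mono sb let2; rewrite doubleK -et leq_add2r.
Qed.

Lemma staircase_rank_le a b :
  (forall p, b p <= a p) -> rank a <= rank b.
Proof. by move=> leba; apply: leq_sum => p _; apply: leq_sub2l. Qed.

Lemma staircase_rank_lt a b p : (forall p, b p <= a p) ->
  p < D -> b p < a p <= M -> rank a < rank b.
Proof.
move=> leba ltpD ltba; rewrite /staircase_rank.
rewrite (bigD1 (Ordinal ltpD)) // [ltnRHS](bigD1 (Ordinal ltpD)) //= -addSn.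
by apply: leq_add; [lia | apply: leq_sum => q _; apply: leq_sub2l].
Qed.

Lemma staircase_facet_eq a b : staircase M D a -> staircase M D b ->
  (forall p, p < D -> a p = b p) -> facet a = facet b.
Proof.
move=> [_ _ staba] [_ _ stabb] eqab; have {}eqab p : a p = b p.
  by have [/eqab //|leDp] := ltnP p D; rewrite staba ?stabb.
by apply/setP => v; rewrite !inE; apply: eq_existsb => t; rewrite eqab.
Qed.

(** Without its lowest vertex [v], the run of adjacent pairs that starts with the
   [p]-th one is covered by the same run shifted up by one; the other pairs are
   unchanged. *)
Lemma staircase_raise_sub a p v : staircase M D a -> a p < M ->
  v.+1 = a p + p.*2 -> facet a :\ v \subset facet (raise a p).
Proof.
move=> sa ltaM ev; have [mono bnd stab] := sa.
apply/subsetP => x /setD1P[nxv /staircase_facetP[t letd et]].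
have [/andP[lept /eqP eat]|ne] := boolP ((p <= t./2) && (a t./2 == a p)); last first.
  by apply/staircase_facetP; exists t; rewrite // /raise (negPf ne) addn0.
have nt : t != p.*2.
  apply: contra_neq nxv => e; apply/val_inj/eq_add_S.
  by rewrite et ev e doubleK.
have lt2p : p.*2 < t by rewrite ltn_neqAle eq_sym nt; lia.
apply/staircase_facetP; exists t.-1; first lia.
have lep : p <= t.-1./2 by rewrite -[p]doubleK; apply: half_leq; lia.
have e : a t.-1./2 = a p.
  apply/eqP; rewrite eqn_leq (mono _ _ lep) andbT -eat mono //.
  exact/half_leq/leq_pred.
by rewrite /raise lep e eqxx /= et eat; lia.
Qed.

End Staircase.

(** * Monomials as weakly increasing words *)

Lemma mem_mvars m (u : 'X_{1..m}) x : x \in mvars u -> (0 < x <= m)%N.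
Proof.
by case/flattenP => _ /mapP[i _ ->] /nseqP[-> _]; rewrite /= ltn_ord.
Qed.

Lemma count_mvars m (u : 'X_{1..m}) (j : 'I_m) :
  count_mem j.+1 (mvars u) = u j.
Proof.
rewrite count_flatten -map_comp sumnE big_map big_enum /= (bigD1 j) //=.
rewrite count_nseq /= eqxx mul1n big1 ?addn0 // => i nij.
by rewrite count_nseq /= eqSS (inj_eq val_inj) (negPf nij).
Qed.

Lemma size_mvars m (u : 'X_{1..m}) : size (mvars u) = mdeg u.
Proof.
rewrite size_flatten /shape -map_comp sumnE big_map big_enum mdegE.
by apply: eq_bigr => i _ /=; rewrite size_nseq.
Qed.

Lemma sorted_mvars m (u : 'X_{1..m}) : sorted leq (mvars u).
Proof.
rewrite sorted_pairwise; last exact: leq_trans.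
have : pairwise ltn [seq val i | i <- enum 'I_m].
  rewrite val_enum_ord -sorted_pairwise ?iota_ltn_sorted //.
  exact: ltn_trans.
rewrite pairwise_map.
rewrite /mvars; elim: (enum 'I_m) => //= i s IHs /andP[/allP ltis /IHs ps].
rewrite pairwise_cat ps andbT; apply/andP; split.
  apply/allrelP => x y /nseqP[-> _] /flattenP[_ /mapP[j /ltis ltij ->]].
  by case/nseqP => -> _; rewrite leqW.
by elim: (u i) => //= k ->; rewrite andbT all_nseq leqnn orbT.
Qed.

Definition word_mnm m (s : seq nat) : 'X_{1..m} :=
  [multinom count_mem i.+1 s | i < m].

Lemma mvars_word m (s : seq nat) :
  sorted leq s -> {in s, forall x, (0 < x <= m)%N} -> mvars (word_mnm m s) = s.
Proof.
move=> sort_s bnd_s.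
apply: (sorted_eq leq_trans anti_leq) => //; first exact: sorted_mvars.
apply/allP => x; rewrite mem_cat => xs.
have : (0 < x <= m)%N by case/orP: xs => [/mem_mvars|/bnd_s].
case: x {xs} => //= x ltxm.
by rewrite (count_mvars _ (Ordinal ltxm)) mnmE.
Qed.

(** The staircase of [u]; the default value of [nth] supplies the padding. *)
Definition mvars_ext m (u : 'X_{1..m}) (p : nat) : nat := nth m.+1 (mvars u) p.

Lemma mvars_ext_lt m (u : 'X_{1..m}) p :
  (mvars_ext u p < m.+1)%N = (p < mdeg u)%N.
Proof.
rewrite -size_mvars /mvars_ext; have [lt|le] := ltnP p (size (mvars u)).
  by have /andP[_] := mem_mvars (mem_nth m.+1 lt).
by rewrite nth_default // ltnn.
Qed.

Lemma staircase_mvars_ext m (u : 'X_{1..m}) D :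
  (mdeg u <= D)%N -> staircase m.+1 D (mvars_ext u).
Proof.
have bnd p : (0 < mvars_ext u p <= m.+1)%N.
  rewrite /mvars_ext; have [lt|le] := ltnP p (size (mvars u)).
    by have /andP[-> /leqW] := mem_mvars (mem_nth m.+1 lt).
  by rewrite nth_default // leqnn.
move=> leD; split=> // [p q lepq|p leDp]; last first.
  by rewrite /mvars_ext nth_default // size_mvars (leq_trans leD).
have [ltq|leq] := ltnP q (size (mvars u)); last first.
  by rewrite [leqRHS]nth_default //; case/andP: (bnd p).
have ltp := leq_ltn_trans lepq ltq.
by apply: (sorted_leq_nth leq_trans leqnn) => //; apply: sorted_mvars.
Qed.

(** For [t./2 >= mdeg u] the vertex [n - d + t] runs through the tail of the
   squeezed facet, which starts at [n - d + 2 * mdeg u]. *)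
Lemma squeezed_facetE n d (u : 'X_{1..n - d - 1}) :
  (d < n)%N -> (mdeg u <= d./2)%N ->
  squeezed_facet n d u = staircase_facet n d (mvars_ext u).
Proof.
move=> ltdn leu; have nE : n = ((n - d - 1).+1 + d)%N by lia.
have [_ bnd stab] := staircase_mvars_ext (leqnn (mdeg u)).
have leD2 : (d./2.*2 <= d)%N by rewrite -[leqRHS]odd_double_half leq_addl.
apply/setP => v; rewrite inE.
apply/orP/staircase_facetP => [[/existsP[p]|]|[t letd et]].
- rewrite (set_nth_default (n - d - 1).+1) ?size_mvars //.
  rewrite -/(mvars_ext u p) mul2n => /orP[] /eqP ev.
    exists p.*2; rewrite ?doubleK //; have := ltn_ord p; lia.
  exists p.*2.+1; last by rewrite /= uphalf_double ev; lia.
  by have := ltn_ord p; lia.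
- move=> tail; exists (v.+1 - (n - d))%N; first by have := ltn_ord v; lia.
  by rewrite stab; [|rewrite -[mdeg u]doubleK; apply: half_leq]; lia.
have tE := odd_double_half t.
have [ltk|lek] := ltnP t./2 (mdeg u).
  left; apply/existsP; exists (Ordinal ltk) => /=.
  rewrite (set_nth_default (n - d - 1).+1) ?size_mvars //.
  rewrite -/(mvars_ext u _) et mul2n.
  by case: (odd t) tE => /= tE; apply/orP; [right | left]; apply/eqP; lia.
by right; rewrite et stab //; lia.
Qed.

Lemma raise_mono a p : {homo a : i j / (i <= j)%N} ->
  {homo raise a p : i j / (i <= j)%N}.
Proof.
move=> mono i j leij; rewrite /raise; have leaij := mono i j leij.
case: (eqVneq (a i) (a p)) => [ei|_]; last first.
  by rewrite andbF addn0 (leq_trans leaij) ?leq_addr.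
case: (leqP p i) => [lepi|_]; last by rewrite addn0 (leq_trans leaij) ?leq_addr.
by rewrite (leq_trans lepi leij) /=; case: (eqVneq (a j) (a p)); lia.
Qed.

(** If [a p] is less than [m], raising indices is a shift.  If it equals [m], the
   indices from [p] on are all [m], raising turns them into the padding [m.+1],
   and the raised monomial is the divisor given by the first [p] indices. *)
Lemma shifted_order_ideal_raise m (U : 'X_{1..m} -> Prop) u p :
  shifted_order_ideal U -> U u -> (p < mdeg u)%N ->
  exists2 u', U u' & mvars_ext u' =1 raise (mvars_ext u) p.
Proof.
move=> [_ Udiv Ushift] Uu ltp; set a := mvars_ext u.
have [mono bnd stab] := staircase_mvars_ext (leqnn (mdeg u)).
have aE q : (q < mdeg u)%N -> nth 0%N (mvars u) q = a q.
  by move=> ltq; apply: set_nth_default; rewrite size_mvars.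
have ltap : (a p < m.+1)%N by rewrite mvars_ext_lt.
have [eapm|nap] := eqVneq (a p) m.
  pose s := take p (mvars u).
  have sE : mvars (word_mnm m s) = s.
    apply: mvars_word; last by move=> x /mem_take/mem_mvars.
    exact/take_sorted/sorted_mvars.
  exists (word_mnm m s).
    apply: Udiv Uu _; apply/mnm_lepP => i; rewrite mnmE -count_mvars.
    by rewrite -[X in (_ <= count _ X)%N](cat_take_drop p) count_cat leq_addr.
  move=> q; rewrite /mvars_ext sE /raise.
  have [ltqp|lepq] := ltnP q p; first by rewrite nth_take // addn0.
  rewrite nth_default ?size_take ?size_mvars ?ltp //=.
  have := mono p q lepq; have := bnd q; rewrite -/a eapm => /andP[_ leM] lem.
  by case: eqVneq => [->|]; lia.
pose s := mkseq (raise a p) (mdeg u).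
have s_nth q : (q < mdeg u)%N -> nth 0%N s q = raise a p q.
  by move=> ltq; rewrite nth_mkseq.
have sE : mvars (word_mnm m s) = s.
  apply: mvars_word => [|x /mapP[q]].
    rewrite sorted_map sorted_pairwise; last first.
      by move=> j i k; apply: leq_trans.
    have : pairwise leq (iota 0 (mdeg u)).
      by rewrite -sorted_pairwise ?iota_sorted //; apply: leq_trans.
    by apply: sub_pairwise => i j leij; apply: raise_mono.
  rewrite mem_iota add0n => /= ltq ->; rewrite /raise.
  have /andP[gt0 _] := bnd q; have := mvars_ext_lt u q; rewrite ltq -/a => ltaq.
  rewrite addn_gt0 gt0 /=; case: eqVneq => [eaq|_]; last by rewrite andbF; lia.
  by rewrite eaq in ltaq *; case: (p <= q)%N; lia.
have degE : mdeg (word_mnm m s) = mdeg u by rewrite -size_mvars sE size_mkseq.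
exists (word_mnm m s).
  apply: Ushift Uu _; split=> // q ltq.
  by rewrite sE s_nth // aE // leq_addr.
move=> q; have [ltq|leq] := ltnP q (mdeg u).
  by rewrite /mvars_ext sE (set_nth_default 0%N) ?size_mkseq // s_nth.
rewrite /mvars_ext sE nth_default ?size_mkseq // /raise -/(mvars_ext u q) -/a.
rewrite [a q]stab //; move: ltap; case: eqVneq => [->|]; lia.
Qed.

(** A facet [F] is ranked by the staircase of one monomial [u_ F] chosen for it.
   The choice is harmless: if two monomials have the same facet, the restriction
   of each lies in the facet of the other, so by [staircase_restriction_le] their
   staircases bound each other. *)
Lemma squeezed_shelling n d (U : 'X_{1..n - d - 1} -> Prop) :
  (d < n)%N -> shifted_order_ideal U -> degree_at_most d./2 U ->
  exists R r, ranked_shelling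
      [set F | `[< exists2 u, U u & F = squeezed_facet n d u >]] R r
    /\ forall F : {set 'I_n}, (#|R F : {set 'I_n}| <= d./2)%N.
Proof.
move=> ltdn shU degU; set Phi := [set F | _]; set M := (n - d - 1).+1.
have nE : n = (M + d)%N by rewrite /M; lia.
have /choice[u_ uP] : forall F, exists u, F \in Phi ->
    U u /\ F = squeezed_facet n d u.
  move=> F; have [|nPF] := boolP (F \in Phi); last by exists 0%MM.
  by rewrite inE => /asboolP[u Uu eF]; exists u.
pose a F := mvars_ext (u_ F).
have sa F : F \in Phi -> staircase M d./2 (a F).
  by case/uP => /degU leu _; apply: staircase_mvars_ext.
have aE F : F \in Phi -> F = staircase_facet n d (a F).
  by case/uP => /degU leu {1}->; apply: squeezed_facetE.
exists (fun F => staircase_restriction n M d./2 (a F)).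
exists (fun F => staircase_rank M d./2 (a F)).
split=> [|F]; last exact: staircase_restriction_card.
split=> [F PF|F G PF PG nFG sRG|F v PF /staircase_restrictionP[p [ltpD ltaM ev]]].
- by have := @staircase_restriction_sub n d M (a F); rewrite -aE.
- have {}sRG : staircase_restriction n M d./2 (a F)
      \subset staircase_facet n d (a G) by rewrite -aE.
  have leGF := staircase_restriction_le nE (sa F PF) (sa G PG) sRG.
  have [p ltp] : exists p : 'I_d./2, (a G p < a F p)%N.
    apply/existsP; apply: contra_neqT nFG; rewrite negb_exists => /forallP eqa.
    rewrite (aE F PF) (aE G PG); apply: (staircase_facet_eq _ (sa F PF) (sa G PG)).
    move=> p ltpD; apply/eqP; rewrite eqn_leq leGF andbT leqNgt.
    exact: (eqa (Ordinal ltpD)).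
  apply: staircase_rank_lt leGF (ltn_ord p) _; rewrite ltp.
  by have [_ bnd _] := sa F PF; case/andP: (bnd p).
have [Uu eF] := uP F PF.
rewrite mvars_ext_lt in ltaM.
have [u' Uu' eu'] := shifted_order_ideal_raise shU Uu ltaM.
rewrite -(mvars_ext_lt (u_ F)) in ltaM.
have PG : squeezed_facet n d u' \in Phi by rewrite inE; apply/asboolP; exists u'.
set G := squeezed_facet n d u' in PG.
have GE : G = staircase_facet n d (mvars_ext u').
  by apply: squeezed_facetE => //; apply: degU.
have su' : staircase M d./2 (mvars_ext u').
  by apply: staircase_mvars_ext; apply: degU.
have le_aG : forall q, (mvars_ext u' q <= a G q)%N.
  apply: (staircase_restriction_le nE (sa G PG) su').
  by have := @staircase_restriction_sub n d M (a G); rewrite -aE // GE.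
exists G; split=> //.
  apply: leq_ltn_trans (staircase_rank_le _ _ le_aG) _.
  apply: (staircase_rank_lt (p := p)) => // [q|]; rewrite eu' /raise.
    exact: leq_addr.
  by rewrite leqnn eqxx addn1 ltnSn.
apply: subset_trans (_ : staircase_facet n d (raise (a F) p) \subset _).
  have := staircase_raise_sub (sa F PF) ltaM ev; rewrite -aE //; exact.
rewrite GE; apply/subsetP => x; rewrite !inE => /existsP[t /eqP ->].
by apply/existsP; exists t; rewrite eu'.
Qed.

Local Close Scope ring_scope.

Theorem corollary4p3 (K : fieldType) (K_infinite : infinite_type K)
    (n d : nat) (d_gt0 : 0 < d) (d_lt_n : d < n)
    (U : 'X_{1..n - d - 1} -> Prop)
    (U_shifted : shifted_order_ideal U) (U_deg : degree_at_most d./2 U) :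
  weak_lefschetz K (squeezed_sphere n d U).
Proof.
have [R [r [shPhi dimR]]] := squeezed_shelling d_lt_n U_shifted U_deg.
apply: (weak_lefschetz_shelled K_infinite shPhi) => // [|F].
  apply/set0Pn; exists (squeezed_facet n d 0%MM); rewrite inE; apply/asboolP.
  by exists 0%MM => //; case: U_shifted => [[]].
rewrite inE => /asboolP[u /U_deg leu ->]; rewrite squeezed_facetE //.
by apply: staircase_facet_card (staircase_mvars_ext leu); lia.
Qed.
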